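(* The following statements are equivalent for a graph $G$: (i) $G$ is $12$-representable by a $123$-avoiding word. (ii) $G$ has a vertex ordering $\prec$ (a linear ordering of $V(G)$) such that none of the following occurs: (a) vertices $x\prec y\prec z$ with $xy, yz\in E(G)$ and $xz\notin E(G)$; (b) vertices $x\prec y\prec z\prec w$ with $yz\in E(G)$ and $xz, yw\notin E(G)$; (c) vertices $x\prec y\prec z\prec w$ with $xz\in E(G)$ and $xw, yz\notin E(G)$; (d) vertices $x\prec y\prec z\prec w$ with $yw\in E(G)$ and $xw, yz\notin E(G)$. (iii) $G$ is the complement of the intersection graph of a family of unit-length hooks and unit-length sticks.
   Context: All graphs are finite, simple and undirected. Let $[n]=\{1,\ldots,n\}$. For a word $w$ over positive integers, $\mathrm{red}(w)$ is the word obtained from $w$ by replacing each occurrence of the $i$th smallest letter with $i$. For a word (pattern) $p=p_1\cdots p_k$ with $\mathrm{red}(p)=p$, a word $w=w_1\cdots w_\ell$ contains $p$ if there are indices $i_1<\cdots<i_k$ with $\mathrm{red}(w_{i_1}\cdots w_{i_k})=p$; otherwise $w$ avoids $p$ (is $p$-avoiding). A labeled graph with vertex set $[n]$ is $12$-represented by a word $w$ over $[n]$ containing at least one copy of each letter of $[n]$ if for all $i<j$ in $[n]$: $i$ and $j$ are adjacent if and only if every occurrence of $j$ precedes every occurrence of $i$ in $w$. An (unlabeled) graph on $n$ vertices is $12$-representable by a $p$-avoiding word if its vertices can be labeled bijectively by $[n]$ so that the resulting labeled graph is $12$-represented by some $p$-avoiding word. An $L$-shape is the union of a vertical line segment and a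 horizontal line segment in the plane such that the bottom endpoint of the vertical segment coincides with the left endpoint of the horizontal segment; this common point is its corner. Let $\mathcal{L}$ be the line $y=-x$. A hook is an $L$-shape whose corner lies on $\mathcal{L}$. A stick is a horizontal or vertical line segment whose left endpoint (if horizontal) or bottom endpoint (if vertical) lies on $\mathcal{L}$. A hook is of unit length if both its horizontal and its vertical segment have length $1$; a stick is of unit length if it has length $1$. The intersection graph of a family of sets, one for each vertex, has two distinct vertices adjacent if and only if the corresponding sets have nonempty intersection.
   Formalization: In (iii) the hooks and sticks assigned to the vertices are required to be pairwise distinct (they may share corners or endpoints); with repeated sticks allowed, (iii) does not imply (ii), e.g. for K_{2,2,2,2} plus an isolated vertex. *)

(* Defs.v *)
From mathcomp Require Import all_boot all_order all_algebra.
From mathcomp Require Import classical_sets reals.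

Set Implicit Arguments.
Unset Strict Implicit.
Unset Printing Implicit Defensive.

Import Order.TTheory GRing.Theory Num.Theory.

Definition red (w : seq nat) : seq nat :=
  [seq (index a (sort leq (undup w))).+1 | a <- w].

Definition contains (p w : seq nat) : Prop :=
  exists s : seq nat, subseq s w /\ red s = p.

Definition avoids (p w : seq nat) : Prop := ~ contains p w.

(* The vertex set [n] = {1, ..., n} is encoded by 'I_n, the ordinal i standing
   for the label i + 1. *)
Definition represents12 (n : nat) (g : rel 'I_n) (w : seq 'I_n) : Prop :=
  (forall i : 'I_n, i \in w) /\
  (forall i j : 'I_n, (i < j)%N ->
     (g i j <->
      forall s t : nat, onth w s = Some j -> onth w t = Some i -> (s < t)%N)).

Definition representable12_avoiding (p : seq nat) (V : finType) (e : rel V)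
    : Prop :=
  exists f : 'I_#|V| -> V, bijective f /\
  exists w : seq 'I_#|V|,
    represents12 (fun i j => e (f i) (f j)) w /\
    avoids p [seq (val i).+1 | i <- w].

Section Orderings.
Variables (V : finType) (e lt : rel V).

Definition strict_linear_order : Prop :=
  [/\ irreflexive lt, transitive lt & forall x y, x != y -> lt x y || lt y x].

Definition pattern_a : Prop :=
  exists x y z : V,
    [/\ lt x y, lt y z, e x y, e y z & ~~ e x z].

Definition pattern_b : Prop :=
  exists x y z w : V,
    [/\ lt x y, lt y z & lt z w] /\ [/\ e y z, ~~ e x z & ~~ e y w].

Definition pattern_c : Prop :=
  exists x y z w : V,
    [/\ lt x y, lt y z & lt z w] /\ [/\ e x z, ~~ e x w & ~~ e y z].

Definition pattern_d : Prop :=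
  exists x y z w : V,
    [/\ lt x y, lt y z & lt z w] /\ [/\ e y w, ~~ e x w & ~~ e y z].

End Orderings.

Local Open Scope classical_set_scope.
Local Open Scope ring_scope.

Section Plane.
Variable R : realType.
Implicit Types (c : R * R) (l : R) (S : set (R * R)).

Definition vsegment c l : set (R * R) :=
  [set q | q.1 = c.1 /\ c.2 <= q.2 <= c.2 + l].

Definition hsegment c l : set (R * R) :=
  [set q | c.1 <= q.1 <= c.1 + l /\ q.2 = c.2].

Definition antidiagonal : set (R * R) := [set q | q.2 = - q.1].

Definition unit_hook S : Prop :=
  exists c, antidiagonal c /\ S = vsegment c 1 `|` hsegment c 1.

Definition unit_stick S : Prop :=
  exists c, antidiagonal c /\ (S = hsegment c 1 \/ S = vsegment c 1).

End Plane.

Definition intersection_adj (T : Type) (V : finType) (S : V -> set T) (x y : V)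
    : Prop :=
  x <> y /\ S x `&` S y !=set0.

Definition complement_adj (V : finType) (adj : V -> V -> Prop) (x y : V)
    : Prop :=
  x <> y /\ ~ adj x y.

(* A family consists of pairwise distinct hooks and sticks, whence the
   injectivity; distinct members may still share their point of the line
   y = -x.  Repeated sticks must be excluded: the disjoint union of K_{2,2,2,2}
   and an isolated vertex would otherwise be realised (a hook and four sticks
   crossing it, each stick taken twice), although none of its vertex orderings
   avoids all of pattern_a, ..., pattern_d. *)
Definition co_unit_hook_stick (R : realType) (V : finType) (e : rel V) : Prop :=
  exists S : V -> set (R * R),
    [/\ injective S,
        forall v, unit_hook (S v) \/ unit_stick (S v)
      & forall x y, e x y <-> complement_adj (intersection_adj S) x y].

(* Main.v *)
Require Import Defs.
From mathcomp Require Import all_boot all_order all_algebra.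
From mathcomp Require Import classical_sets reals.
From mathcomp Require Import boolp zify lra.

Set Implicit Arguments.
Unset Strict Implicit.
Unset Printing Implicit Defensive.

(** All three conditions say that, along a suitable ordering of the vertices,
    the nonedges have one and the same shape.  A pair x < y is a nonedge exactly
    when x may start a nonedge, y may end one, and y is within reach of x, where
    reach is monotone in both arguments ([nonedgeE]).  Here x starts a nonedge
    if it has a later nonneighbour, y ends one if it has an earlier
    nonneighbour, and y is reached from x as soon as some nonedge (a, b)
    satisfies a <= x and y <= b.  A vertex adjacent to all others is counted as
    an end.  Excluding the four patterns is what allows such a nonedge (a, b) to
    be shrunk to (x, y).

    Geometrically, starting is having a horizontal segment, ending is having a
    vertical one, and being within reach is having corners at distance at most
    1: two shapes with corners c < c' on y = -x meet iff the first has a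
    horizontal part, the second a vertical part, and c' <= c + 1
    ([shapes_meet]).  A monotone reach relation is realised by corners on the
    line, placed greedily from left to right ([exists_unit_placement]).
    Conversely, ordering shapes by their corners, and shapes with a common
    corner as horizontal stick, hook, vertical stick, makes nonadjacency take
    the above form, which excludes the four patterns ([pattern_free_of_flags]).

    For words, a 123-avoiding word is a shuffle of two weakly decreasing words.
    One lists the vertices that start a nonedge and the other those that end
    one, and x of the first list is put before y of the second iff y is within
    reach of x ([precedes]); then x < y occur in this order somewhere in the
    word iff xy is a nonedge.  Conversely, in a graph represented by a word
    pattern (a) never occurs along the labels, and each of (b), (c), (d) forces
    a 123 in the word ([pattern_free_of_word]). *)

(** * Pattern-free orderings *)

Section PatternFree.
Variables (V : finType) (e lt : rel V).

Definition pattern_free : Prop :=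
  [/\ ~ pattern_a e lt, ~ pattern_b e lt, ~ pattern_c e lt & ~ pattern_d e lt].

(** The patterns read as closure rules on nonedges, the form in which they are
    used: the first splits a nonedge at an intermediate vertex, the other three
    combine two crossing or nested nonedges. *)
Lemma pattern_freeP :
  pattern_free <->
  (forall x y z, lt x y -> lt y z -> ~~ e x z -> ~~ e x y || ~~ e y z) /\
  (forall x y z w, lt x y -> lt y z -> lt z w ->
    [/\ ~~ e x z -> ~~ e y w -> ~~ e y z,
        ~~ e x w -> ~~ e y z -> ~~ e x z
      & ~~ e x w -> ~~ e y z -> ~~ e y w]).
Proof.
split=> [[Na Nb Nc Nd]|[Ha Hbcd]].
  split=> [x y z xy yz Nxz|x y z w xy yz zw].
    rewrite -negb_and; apply/negP => /andP[exy eyz].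
    by apply: Na; exists x, y, z.
  split=> N1 N2; apply/negP => E.
  - by apply: Nb; exists x, y, z, w.
  - by apply: Nc; exists x, y, z, w.
  - by apply: Nd; exists x, y, z, w.
split.
- case=> x [y [z [xy yz exy eyz Nxz]]].
  by move: (Ha x y z xy yz Nxz); rewrite exy eyz.
- case=> x [y [z [w [[xy yz zw] [E N1 N2]]]]].
  by have [/(_ N1 N2)] := Hbcd x y z w xy yz zw; rewrite E.
- case=> x [y [z [w [[xy yz zw] [E N1 N2]]]]].
  by have [_ /(_ N1 N2)] := Hbcd x y z w xy yz zw; rewrite E.
- case=> x [y [z [w [[xy yz zw] [E N1 N2]]]]].
  by have [_ _ /(_ N1 N2)] := Hbcd x y z w xy yz zw; rewrite E.
Qed.

End PatternFree.

Lemma pattern_free_relpre (T V : finType) (f : T -> V) (e lt : rel V) :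
  pattern_free e lt -> pattern_free (relpre f e) (relpre f lt).
Proof.
move=> /pattern_freeP[Ha Hbcd]; apply/pattern_freeP.
by split=> [x y z|x y z w]; [apply: Ha | apply: Hbcd].
Qed.

Lemma eq_pattern_free (V : finType) (e e' lt lt' : rel V) :
  e =2 e' -> lt =2 lt' -> pattern_free e lt -> pattern_free e' lt'.
Proof.
move=> ee ll /pattern_freeP[Ha Hbcd]; apply/pattern_freeP.
split=> [x y z|x y z w]; rewrite -!ee -!ll; [exact: Ha | exact: Hbcd].
Qed.

Definition ordinal_lt n : rel 'I_n := fun i j => i < j.

Section Rank.
Variables (V : finType) (lt : rel V) (lt_lin : strict_linear_order lt).

Let rank (x : V) := #|[set u | lt u x]|.

Let rank_homo x y : lt x y -> rank x < rank y.
Proof.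
have [irr tr _] := lt_lin => xy; apply/proper_card/properP; split.
  by apply/fintype.subsetP => u; rewrite !inE => /tr; apply.
by exists x; rewrite !inE // irr.
Qed.

Let rankE x y : (rank x < rank y) = lt x y.
Proof.
have [irr tr tot] := lt_lin.
apply/idP/idP => [ltr|]; last exact: rank_homo.
have /tot/orP[//|/rank_homo] : x != y.
  by apply: contraTneq ltr => ->; rewrite ltnn.
by rewrite ltnNge (ltnW ltr).
Qed.

Let rank_bound x : rank x < #|V|.
Proof.
have [irr _ _] := lt_lin; rewrite -cardsT; apply/proper_card/properP.
by split; [apply: finset.subsetT | exists x; rewrite !inE ?irr].
Qed.

(** Sending a vertex to the number of its predecessors is an injection into
    ['I_#|V|], hence a bijection, whose inverse is the enumeration. *)
Lemma strict_linear_enumeration :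
  exists2 f : 'I_#|V| -> V, bijective f & relpre f lt =2 @ordinal_lt #|V|.
Proof.
have [irr tr tot] := lt_lin.
pose g x := Ordinal (rank_bound x).
have ginj : injective g.
  move=> x y /(congr1 val)/= rxy; apply/eqP; apply: contraT => /tot.
  by rewrite -!rankE rxy ltnn.
have [f gK fK] : bijective g by apply: inj_card_bij; rewrite // card_ord.
exists f => [|i j]; first by exists g.
by rewrite /= -rankE -[rank _]/(val (g _)) -[rank (f j)]/(val (g _)) !fK.
Qed.

End Rank.

(** Words and corner placements both proceed along the positions of an ordering,
    so the existence of an ordering is traded for a labelling. *)
Lemma pattern_free_enumeration (V : finType) (e : rel V) :
  (exists lt : rel V, strict_linear_order lt /\ pattern_free e lt) <->
  exists2 f : 'I_#|V| -> V, bijective f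
    & pattern_free (relpre f e) (@ordinal_lt #|V|).
Proof.
split=> [[lt [lin free]]|[f [g fK gK] free]].
  have [f fbij fE] := strict_linear_enumeration lin.
  exists f => //; apply: (eq_pattern_free _ fE) => //.
  exact: pattern_free_relpre.
exists (relpre g (@ordinal_lt #|V|)); split.
  split=> [x|y x z|x y xy]; rewrite /= /ordinal_lt ?ltnn //.
    exact: ltn_trans.
  by rewrite -neq_ltn -(inj_eq (can_inj gK)) in xy *.
apply: eq_pattern_free (pattern_free_relpre g free) => // x y.
by rewrite /= !gK.
Qed.

(** * The staircase of nonedges *)

Section Staircase.
Variables (n : nat) (e : rel 'I_n).

Definition starts (x : 'I_n) : bool := [exists y : 'I_n, (x < y) && ~~ e x y].

(** A vertex adjacent to all others still needs a letter in the word and a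
    segment in the plane; the first disjunct arbitrarily makes it an end.  By
    pattern (a) no nonedge passes over it, so it is out of reach of all earlier
    vertices. *)
Definition ends (y : 'I_n) : bool :=
  ~~ starts y || [exists x : 'I_n, (x < y) && ~~ e x y].

(** The least relation that contains the nonedges and all pairs y <= x, and is
    monotone in the sense of [reaches_mono].  It is defined on [nat] because
    corners are placed by induction on the number of vertices. *)
Definition reaches (x y : nat) : bool :=
  (y <= x) || [exists a : 'I_n, exists b : 'I_n,
                 [&& a <= x, y <= b, a < b & ~~ e a b]].

Lemma reaches_ge x y : y <= x -> reaches x y.
Proof. by rewrite /reaches => ->. Qed.

Lemma reaches_mono x x' y y' :
  x <= x' -> y' <= y -> reaches x y -> reaches x' y'.
Proof.
move=> xx yy /orP[yx|/existsP[a /existsP[b /and4P[ax yb ab Nab]]]].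
  by apply: reaches_ge; lia.
apply/orP; right; apply/existsP; exists a; apply/existsP; exists b.
by rewrite ab Nab !andbT (leq_trans ax) // (leq_trans yy).
Qed.

Hypothesis e_free : pattern_free e (@ordinal_lt n).

(** A nonedge (a, b) around (x, y) is shrunk one endpoint at a time.  With u a
    later nonneighbour of x, the nonedges (a, b) and (x, u) cross or are nested,
    which gives the nonedge (x, b) by (b) or (d); with v an earlier nonneighbour
    of y, the nonedges (x, b) and (v, y) give (x, y) by (b) or (c). *)
Lemma nonedgeE (x y : 'I_n) :
  x < y -> ~~ e x y = [&& starts x, ends y & reaches x y].
Proof.
move=> xy; have [Ha Hbcd] := (pattern_freeP _ _).1 e_free.
apply/idP/and3P => [Nxy|[/existsP[u /andP[xu Nxu]] Ey]].
  split; first by apply/existsP; exists y; rewrite xy.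
    by apply/orP; right; apply/existsP; exists x; rewrite xy.
  apply/orP; right; apply/existsP; exists x; apply/existsP; exists y.
  by rewrite !leqnn xy.
rewrite /reaches leqNgt xy /=.
case/existsP=> a /existsP[b /and4P[ax yb ab Nab]].
(* If y ends nothing, rule (a) applied to a < y < b supplies a nonedge at y. *)
have [v vy Nvy] : exists2 v : 'I_n, v < y & ~~ e v y.
  case/orP: Ey => [Sy|/existsP[v /andP[]]]; last by exists v.
  have ay : a < y by apply: leq_ltn_trans ax xy.
  have [yb'|by_] := ltnP y b; last first.
    by exists a => //; have <- : b = y by apply: val_inj => /=; lia.
  case/orP: (Ha a y b ay yb' Nab) => [|Nyb]; first by exists a.
  by case/existsP: Sy; exists b; rewrite yb'.
have xb : x < b by apply: leq_trans yb.
have Nxb : ~~ e x b.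
  have [ax'|xa] := ltnP a x; last first.
    by have <- : a = x by apply: val_inj => /=; lia.
  case: (ltngtP u b) => [ub|bu|/val_inj <-] //.
    by have [_ _] := Hbcd a x u b ax' xu ub; apply.
  by have [+ _ _] := Hbcd a x b u ax' xb bu; apply.
have [yb'|by_] := ltnP y b; last first.
  by have <- : b = y by apply: val_inj => /=; lia.
case: (ltngtP x v) => [xv|vx|/val_inj ->] //.
  by have [_ + _] := Hbcd x v y b xv vy yb'; apply.
by have [+ _ _] := Hbcd v x y b vx xy yb'; apply.
Qed.

End Staircase.

(** * Words avoiding 123 *)

Lemma red_increasing3 a b c : a < b -> b < c -> red [:: a; b; c] = [:: 1; 2; 3].
Proof.
move=> ab bc; have ac := ltn_trans ab bc.
rewrite /red undup_id; last first.
  by rewrite /= !inE (ltn_eqF ab) (ltn_eqF ac) (ltn_eqF bc).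
rewrite sorted_sort ?/= ?(ltnW ab) ?(ltnW bc) //; last exact: leq_trans.
by rewrite !eqxx (ltn_eqF ab) (ltn_eqF ac) (ltn_eqF bc).
Qed.

Lemma red_eq123 s : red s = [:: 1; 2; 3] ->
  exists a b c, s = [:: a; b; c] /\ a < b < c.
Proof.
case: s => [|a [|b [|c [|]]]] //; rewrite /red.
set u := sort _ _ => -[ia ib ic]; exists a, b, c; split=> //.
have us : sorted leq u by apply: sort_sorted; apply: leq_total.
have memu x : (x \in u) = (x \in [:: a; b; c]).
  by rewrite mem_sort mem_undup.
have ltu x y : x \in u -> y \in u -> index x u < index y u -> x < y.
  move=> xu yu ixy; rewrite ltn_neqAle (sorted_ltn_index leq_trans us) // andbT.
  by apply: contraTneq ixy => ->; rewrite ltnn.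
by apply/andP; split; apply: ltu; rewrite ?memu ?inE ?eqxx ?orbT // ?ia ?ib ?ic.
Qed.

Lemma avoids123P u : avoids [:: 1; 2; 3] u <->
  forall a b c, subseq [:: a; b; c] u -> ~~ (a < b < c).
Proof.
split=> [Nu a b c su|Nu [s [su /red_eq123[a [b [c [sE]]]]]]].
  apply/negP => /andP[ab bc]; apply: Nu; exists [:: a; b; c].
  by rewrite red_increasing3.
by apply/negP; apply: Nu; rewrite -sE.
Qed.

Lemma subseq3_onth (T : eqType) (w : seq T) s t u a b c : s < t -> t < u ->
  onth w s = Some a -> onth w t = Some b -> onth w u = Some c ->
  subseq [:: a; b; c] w.
Proof.
elim: w s t u => [|x w IH] s t u; first by rewrite /= onth0n.
case: s t u => [|s] [|t] [|u] //; last first.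
  move=> st tu sa tb uc; apply: subseq_trans (subseq_cons w x).
  exact: (IH s t u).
move=> _ tu [->] tb uc; rewrite /= eqxx.
elim: w t u tu tb uc {IH} => [|y w IH] t u; first by rewrite /= onth0n.
case: t u => [|t] [|u] //= tu.
  by case=> -> uc; rewrite eqxx sub1seq; apply/onthP; exists u.
by move=> tb uc; exact: (subseq_trans (IH t u tu tb uc) (subseq_cons w y)).
Qed.

Section WordOfOrdering.
Variables (n : nat) (e : rel 'I_n).

Lemma represents12_nonedge w (i j : 'I_n) : represents12 e w -> i < j ->
  ~~ e i j -> exists s t, [/\ s < t, onth w s = Some i & onth w t = Some j].
Proof.
case=> _ /(_ i j) wE ij /negP Nij; apply: contrapT => N; apply: Nij.
apply/(wE ij) => s t sj ti; rewrite ltnNge leq_eqVlt.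
apply/negP => /orP[/eqP ts|ts]; last by apply: N; exists t, s.
by move: sj; rewrite -ts ti => -[ij']; rewrite ij' ltnn in ij.
Qed.

(** If x < y is an edge, all copies of y come before all copies of x.  In each
    of the patterns (b), (c), (d), such an edge places the witnesses of the two
    nonedges one after the other, and three of the four letters form a 123.
    Pattern (a) needs only that y occurs. *)
Lemma pattern_free_of_word w : represents12 e w ->
  avoids [:: 1; 2; 3] [seq (val i).+1 | i <- w] ->
  pattern_free e (@ordinal_lt n).
Proof.
move=> wrep /avoids123P Nw; have [w_all wE] := wrep.
have N123 s t u (i j k : 'I_n) : onth w s = Some i -> onth w t = Some j ->
    onth w u = Some k -> i < j -> j < k -> s < t -> t < u -> False.
  move=> si tj uk ij jk st tu.
  have := subseq3_onth st tu si tj uk.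
  move/(map_subseq (fun i : 'I_n => (val i).+1)) => /=.
  by move/Nw; rewrite !ltnS ij jk.
have before (i j : 'I_n) s t : i < j -> e i j ->
    onth w s = Some j -> onth w t = Some i -> s < t.
  by move=> /wE[+ _] eij; apply.
apply/pattern_freeP; split=> [x y z xy yz|x y z w' xy yz zw].
  case/(represents12_nonedge wrep (ltn_trans xy yz)) => s [t [st sx tz]].
  have /onthP[u uy] := w_all y; rewrite -negb_and; apply/negP => /andP[exy eyz].
  have := before _ _ _ _ xy exy uy sx.
  by have := before _ _ _ _ yz eyz tz uy; lia.
have xz := ltn_trans xy yz; have yw := ltn_trans yz zw.
have xw := ltn_trans xy yw.
split=> N1 N2; apply/negP => E.
- have [s [t [st sx tz]]] := represents12_nonedge wrep xz N1.
  have [s' [t' [st' sy tw]]] := represents12_nonedge wrep yw N2.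
  have zy := before _ _ _ _ yz E tz sy.
  exact: (N123 _ _ _ _ _ _ sx tz tw xz zw st (ltn_trans zy st')).
- have [s [t [st sx tw]]] := represents12_nonedge wrep xw N1.
  have [s' [t' [st' sy tz]]] := represents12_nonedge wrep yz N2.
  have zx := before _ _ _ _ xz E tz sx.
  exact: (N123 _ _ _ _ _ _ sy tz tw yz zw st' (ltn_trans zx st)).
- have [s [t [st sx tw]]] := represents12_nonedge wrep xw N1.
  have [s' [t' [st' sy tz]]] := represents12_nonedge wrep yz N2.
  have wy := before _ _ _ _ yw E tw sy.
  exact: (N123 _ _ _ _ _ _ sx sy tz xy yz (ltn_trans st wy) st').
Qed.

(** An item is a vertex with a role, [true] for starting and [false] for ending
    nonedges.  Items of the same role are listed in decreasing order; a start x
    comes before an end y iff y is within reach of x.  Monotonicity of [reaches]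
    makes this a total preorder, so the word is obtained by sorting. *)
Definition precedes (p q : 'I_n * bool) : bool :=
  match p.2, q.2 with
  | true, false => reaches e p.1 q.1
  | false, true => ~~ reaches e q.1 p.1
  | _, _ => q.1 <= p.1
  end.

Definition has_role (p : 'I_n * bool) : bool :=
  if p.2 then starts e p.1 else ends e p.1.

Definition role_seq : seq ('I_n * bool) :=
  sort precedes [seq p <- enum {: 'I_n * bool} | has_role p].

Lemma precedes_total : total precedes.
Proof.
by move=> [x []] [y []]; rewrite /precedes /= ?leq_total // ?orbN // orNb.
Qed.

Lemma precedes_trans : transitive precedes.
Proof.
have up x y z : ~~ reaches e x z -> reaches e y z -> x <= y.
  move=> Nxz yz; rewrite leqNgt; apply: contra Nxz => /ltnW yx.
  exact: reaches_mono yz.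
have down x y z : ~~ reaches e x y -> reaches e x z -> z <= y.
  move=> Nxy xz; rewrite leqNgt; apply: contra Nxy => /ltnW yz.
  exact: reaches_mono xz.
move=> [y []] [x []] [z []]; rewrite /precedes /=.
- by move=> yx zy; apply: leq_trans yx.
- by move=> yx; apply: reaches_mono.
- by move=> Nyx zy; apply: contra Nyx; apply: reaches_mono.
- exact: down.
- by move=> xy Nzy; apply: up Nzy xy.
- by move=> xy zy; apply: reaches_mono xy.
- by move=> yx; apply: contra; apply: reaches_mono.
- by move=> yx zy; apply: leq_trans yx.
Qed.

Lemma role_seq_sorted : sorted precedes role_seq.
Proof. exact: sort_sorted precedes_total _. Qed.

Lemma mem_role_seq p : (p \in role_seq) = has_role p.
Proof. by rewrite mem_sort mem_filter mem_enum andbT. Qed.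

Lemma role_seq_onth s t p q : s < t ->
  onth role_seq s = Some p -> onth role_seq t = Some q -> precedes p q.
Proof.
move=> st sp tq; have bs : s < size role_seq by rewrite -onthTE sp.
have bt : t < size role_seq by rewrite -onthTE tq.
have := sorted_ltn_nth precedes_trans p role_seq_sorted s t bs bt st.
by rewrite (@onth_nth _ p _ _ _ sp) (@onth_nth _ p _ _ _ tq).
Qed.

(** Among three letters two have the same role, and these decrease weakly. *)
Lemma role_word_avoids :
  avoids [:: 1; 2; 3] [seq (val i).+1 | i <- map fst role_seq].
Proof.
apply/avoids123P => a b c; rewrite -map_comp => /subseqP[m _].
rewrite -map_mask.
have: sorted precedes (mask m role_seq).
  exact: subseq_sorted precedes_trans _ _ (mask_subseq m _) role_seq_sorted.
case: (mask m _) => [|p [|q [|r [|]]]] //= /and3P[pq qr _] [-> -> ->].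
have pr := precedes_trans pq qr; rewrite !ltnS; apply/negP => /andP[ab bc].
move: pq qr pr; have ac := ltn_trans ab bc.
case: p q r ab bc ac => [x []] [y []] [z []]; rewrite /precedes /= => xy yz xz.
all: by rewrite ?(leqNgt y) ?(leqNgt z) ?xy ?yz ?xz ?andbF.
Qed.

Hypothesis e_free : pattern_free e (@ordinal_lt n).

(** For i < j, a copy of i before a copy of j can only be i as a start and j as
    an end: equal roles are decreasing, and an end i lies after the start j
    because j reaches the smaller i.  Such copies exist iff i starts, j ends and
    j is within reach of i, which is the criterion of [nonedgeE]. *)
Lemma role_word_represents : represents12 e (map fst role_seq).
Proof.
split=> [i|i j ij].
  have : has_role (i, true) || has_role (i, false).
    by rewrite /has_role /ends /=; case: (starts e i).
  by case/orP; rewrite -mem_role_seq => /(map_f fst).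
have onth_fst s k : onth (map fst role_seq) s = Some k ->
    exists b, onth role_seq s = Some (k, b) /\ has_role (k, b).
  rewrite onth_map; case E: onth => [[k' b]|] //= [<-]; exists b; split=> //.
  by rewrite -mem_role_seq; apply/onthP; exists s.
split=> [eij s t|]; last first.
  move=> before; apply: contraT.
  rewrite (nonedgeE e_free ij) => /and3P[Si Ej Rij].
  have /onthP[s si] : (i, true) \in role_seq by rewrite mem_role_seq.
  have /onthP[t tj] : (j, false) \in role_seq by rewrite mem_role_seq.
  have ts : t < s by apply: before; rewrite onth_map ?si ?tj.
  by have := role_seq_onth ts tj si; rewrite /precedes /= Rij.
case/onth_fst=> b [sj hj] /onth_fst[c [ti hi]].
rewrite ltnNge leq_eqVlt; apply/negP => /orP[/eqP ts|ts].
  by move: sj; rewrite -ts ti => -[ij' _]; rewrite ij' ltnn in ij.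
have := role_seq_onth ts ti sj; case: c b hi hj {ti sj} => [] [];
  rewrite /precedes /has_role /= => hi hj; rewrite ?(leqNgt j) ?ij //.
- by move=> Rij; move: eij; apply/negP; rewrite (nonedgeE e_free ij) hi hj.
- by rewrite reaches_ge // ltnW.
Qed.

End WordOfOrdering.

Lemma pattern_free_wordP n (e : rel 'I_n) :
  pattern_free e (@ordinal_lt n) <->
  exists w, represents12 e w /\ avoids [:: 1; 2; 3] [seq (val i).+1 | i <- w].
Proof.
split=> [free|[w [wrep wav]]]; last exact: pattern_free_of_word wrep wav.
exists (map fst (role_seq e)).
by split; [exact: role_word_represents | exact: role_word_avoids].
Qed.

(** * Placing corners at unit distances *)

Section Placement.
Local Open Scope ring_scope.
Import Order.TTheory GRing.Theory Num.Theory.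
Variable R : realFieldType.

Lemma exists_between_seq1 a (B : seq R) : {in B, forall b, a < b} ->
  exists2 v, a < v & {in B, forall b, v < b}.
Proof.
elim: B => [|b B IH] aB; first by exists (a + 1); rewrite ?ltrDl.
have [v av vB] : exists2 v, a < v & {in B, forall b, v < b}.
  by apply: IH => x xB; apply: aB; rewrite inE xB orbT.
have ab : a < b by apply: aB; rewrite inE eqxx.
exists (Num.min v ((a + b) / 2)) => [|x]; first by rewrite lt_min av; lra.
by rewrite inE gt_min => /predU1P[->|/vB ->] //; apply/orP; right; lra.
Qed.

Lemma exists_between_seqs (A B : seq R) : {in A & B, forall a b, a < b} ->
  exists v, {in A, forall a, a < v} /\ {in B, forall b, v < b}.
Proof.
elim: A => [|a A IH] AB.
  exists (foldr Num.min 0 B - 1); split=> // b.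
  elim: B {AB} => //= b' B IH; rewrite inE => /predU1P[->|/IH].
    have : Num.min b' (foldr Num.min 0 B) <= b' by rewrite ge_min lexx.
    lra.
  have : Num.min b' (foldr Num.min 0 B) <= foldr Num.min 0 B.
    by rewrite ge_min lexx orbT.
  lra.
have [v [Av vB]] : exists v,
    {in A, forall a, a < v} /\ {in B, forall b, v < b}.
  by apply: IH => x y xA; apply: AB; rewrite inE xA orbT.
have [va|av] := lerP v a; last first.
  by exists v; split=> // x; rewrite inE => /predU1P[->|/Av].
have aB : {in B, forall b, a < b} by move=> b; apply: AB; rewrite inE eqxx.
have [u au uB] := exists_between_seq1 aB; exists u; split=> // x.
by rewrite inE => /predU1P[->|/Av xv] //; lra.
Qed.

(** The last corner v must exceed every p i, and p i + 1 if n is out of reach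
    of i, and stay below p j + 1 whenever n is within reach of j.  Monotonicity
    of [N] and the earlier placements make each lower bound smaller than each
    upper bound.  The strict inequality within reach keeps the room for v open;
    with distance exactly 1 the induction would fail. *)
Lemma exists_unit_placement (N : rel nat) n :
  (forall x, N x x) ->
  (forall x x' y y', (x <= x')%N -> (y' <= y)%N -> N x y -> N x' y') ->
  exists p : nat -> R, forall i j, (i < j)%N -> (j < n)%N ->
    p i < p j /\ if N i j then p j < p i + 1 else p i + 1 < p j.
Proof.
move=> Nrefl Nmono; elim: n => [|n [p pP]]; first by exists (fun=> 0).
pose A := [seq p i | i <- iota 0 n] ++
  [seq p i + 1 | i <- iota 0 n & ~~ N i n].
pose B := [seq p i + 1 | i <- iota 0 n & N i n].
have AB : {in A & B, forall a b, a < b}.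
  move=> a b; rewrite mem_cat => aA /mapP[j]; rewrite mem_filter mem_iota /=.
  move=> /andP[Nj jn] ->{b}; case/orP: aA => /mapP[i].
    rewrite mem_iota /= => iN ->; case: (ltngtP i j) => [ij|ji|->]; last lra.
      by have [] := pP i j ij jn; lra.
    have [_] := pP j i ji iN.
    by rewrite (Nmono j j n i) // ltnW.
  rewrite mem_filter mem_iota /= => /andP[Ni iN] ->.
  have ij : (i < j)%N.
    by rewrite ltnNge; apply: contra Ni => ji; apply: Nmono Nj.
  by have [] := pP i j ij jn; lra.
have [v [Av vB]] := exists_between_seqs AB.
exists (fun i => if i == n then v else p i) => i j ij jn1.
have iN : (i < n)%N by lia.
rewrite (ltn_eqF iN); have [->|jn] := eqVneq j n; last by apply: pP => //; lia.
have ii : i \in iota 0 n by rewrite mem_iota.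
split; first by apply: Av; rewrite mem_cat map_f.
case: ifPn => Ni; first by apply/vB/map_f; rewrite mem_filter Ni.
apply: Av; rewrite mem_cat; apply/orP; right; apply: map_f.
by rewrite mem_filter Ni.
Qed.

End Placement.

(** * Unit hooks and sticks *)

Section Shapes.
Local Open Scope classical_set_scope.
Local Open Scope ring_scope.
Import Order.TTheory GRing.Theory Num.Theory.
Variable R : realType.
Implicit Types (c : R) (h v : bool) (S : set (R * R)).

Definition shape c h v : set (R * R) :=
  [set q | h /\ hsegment (c, - c) 1 q \/ v /\ vsegment (c, - c) 1 q].

Lemma unit_shapeP S : unit_hook S \/ unit_stick S <->
  exists c h v, h || v /\ S = shape c h v.
Proof.
have diag (c : R * R) : antidiagonal c -> c = (c.1, - c.1).
  by case: c => x y; rewrite /antidiagonal /= => ->.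
split.
  case=> [[c [/diag -> ->]]|[c [/diag -> [->|->]]]] /=.
  - exists c.1, true, true; split=> //; apply/seteqP.
    split=> q; rewrite /shape /=; first by case=> H; [right | left].
    by case=> -[_ H]; [right | left].
  - exists c.1, true, false; split=> //; apply/seteqP.
    by split=> q /=; rewrite /shape /=; [left | case=> -[]].
  - exists c.1, false, true; split=> //; apply/seteqP.
    by split=> q /=; rewrite /shape /=; [right | case=> -[]].
case=> c [[] [[] [//= _ ->]]]; [left|right|right]; exists (c, - c); split=> //.
- apply/seteqP.
  split=> q; rewrite /shape /=; last by case=> H; [right | left].
  by case=> -[_ H]; [right | left].
- left; apply/seteqP.
  by split=> q /=; rewrite /shape /=; [case=> -[] | left].
- right; apply/seteqP.
  by split=> q /=; rewrite /shape /=; [case=> -[] | right].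
Qed.

Lemma shape_corner c h v : h || v -> shape c h v (c, - c).
Proof.
rewrite /shape /hsegment /vsegment /=.
by case/orP=> ->; [left | right]; rewrite !lexx lerDl ler01.
Qed.

(** A shape meets y = -x in its corner only. *)
Lemma shape_corner_inj c h v c' h' v' :
  h || v -> shape c h v = shape c' h' v' -> c = c'.
Proof.
move=> hv E; have := shape_corner c hv; rewrite E.
by rewrite /shape /hsegment /vsegment /= => -[] [_ []]; lra.
Qed.

(** Two horizontal segments lie on different lines, as do two vertical ones, and
    a vertical segment at c lies to the left of everything at c' > c.  The
    remaining pair crosses at (c', -c). *)
Lemma shapes_meet c h v c' h' v' : c < c' ->
  (shape c h v `&` shape c' h' v' !=set0) <-> [&& h, v' & c' <= c + 1].
Proof.
move=> cc; rewrite /shape /hsegment /vsegment /=; split.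
  case=> [[x y]] /= [[[Hh H1]|[Hv H1]] [[Hh' H2]|[Hv' H2]]].
  - by move: H1 H2 => [H1 H2] [H3 H4]; lra.
  - by rewrite Hh Hv' /=; move: H1 H2 => [H1 H2] [H3 H4]; lra.
  - by move: H1 H2 => [H1 H2] [H3 H4]; lra.
  - by move: H1 H2 => [H1 H2] [H3 H4]; lra.
case/and3P=> -> -> H; exists (c', - c) => /=.
by split; [left | right]; split=> //; split=> //; lra.
Qed.

End Shapes.

Section Geometry.
Local Open Scope ring_scope.
Import Order.TTheory GRing.Theory Num.Theory.
Variables (R : realType) (V : finType) (e lt : rel V).

(** Monotonicity of [c] transfers the distance bound from an outer pair to an
    inner one.  For pattern (a) the middle vertex, having at least one segment,
    meets one of the outer two. *)
Lemma pattern_free_of_flags (c : V -> R) (h v : V -> bool) :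
  (forall x, h x || v x) ->
  (forall x y, lt x y -> c x <= c y) ->
  (forall x y, lt x y -> ~~ e x y = [&& h x, v y & c y <= c x + 1]) ->
  transitive lt ->
  pattern_free e lt.
Proof.
move=> hv cle eE tr; apply/pattern_freeP.
split=> [x y z xy yz|x y z w xy yz zw].
  rewrite !eE //; last exact: tr yz.
  move=> /and3P[-> -> cxz] /=; have := cle _ _ xy; have := cle _ _ yz.
  case/orP: (hv y) => -> ? ?; apply/orP; [right | left]; rewrite ?andbT /=; lra.
have xz := tr _ _ _ xy yz; have yw := tr _ _ _ yz zw; have xw := tr _ _ _ xy yw.
have := cle _ _ xy; have := cle _ _ yz; have := cle _ _ zw; rewrite !eE // => *.
by split=> /and3P[H1 H2 H3] /and3P[H4 H5 H6]; apply/and3P; split=> //; lra.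
Qed.

End Geometry.

Section HookStick.
Local Open Scope classical_set_scope.
Local Open Scope ring_scope.
Import Order.TTheory GRing.Theory Num.Theory.
Variables (R : realType) (V : finType) (e : rel V).
Hypotheses (e_sym : symmetric e) (e_irr : irreflexive e).

Lemma co_unit_hook_stick_ordering :
  co_unit_hook_stick R e ->
  exists lt : rel V, strict_linear_order lt /\ pattern_free e lt.
Proof.
case=> S [Sinj Sshape eE].
have /choice[d dP] (x : V) : exists d : R * (bool * bool),
    d.2.1 || d.2.2 /\ S x = shape d.1 d.2.1 d.2.2.
  have /unit_shapeP[c [h [v chv]]] := Sshape x.
  by exists (c, (h, v)).
pose c x := (d x).1; pose h x := (d x).2.1; pose v x := (d x).2.2.
have hv x : h x || v x by have [] := dP x.
have SE x : S x = shape (c x) (h x) (v x) by have [] := dP x.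
pose rank x := (v x + ~~ h x)%N.
(* Ties are broken as horizontal stick < hook < vertical stick.  Then of two
   shapes with a common corner the first has a horizontal segment and the
   second a vertical one, so the meeting criterion for distinct corners holds
   for them as well.  Injectivity of S is what makes this a linear order. *)
pose lt x y := (c x < c y) || (c x == c y) && (rank x < rank y)%N.
have lt_tie x y : c x = c y -> lt x y -> h x && v y.
  move=> cxy; rewrite /lt cxy ltxx eqxx /rank /=.
  by have := hv x; have := hv y; case: (h x) (v x) (h y) (v y) => [] [] [] [].
have lt_le x y : lt x y -> c x <= c y.
  by case/orP=> [/ltW|/andP[/eqP ->]].
have lt_irr : irreflexive lt by move=> x; rewrite /lt ltxx ltnn andbF.
have lt_trans : transitive lt.
  move=> y x z /orP[xy|/andP[/eqP xy rxy]] /orP[yz|/andP[/eqP yz ryz]].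
  - by rewrite /lt (Order.POrderTheory.lt_trans xy yz).
  - by rewrite /lt -yz xy.
  - by rewrite /lt xy yz.
  - by rewrite /lt xy yz eqxx (ltn_trans rxy ryz) orbT.
exists lt; split.
  split=> // x y /eqP xy; rewrite /lt (eq_sym (c y)).
  case: (ltgtP (c x) (c y)) => //= cxy; rewrite -neq_ltn /rank.
  apply/eqP => rxy; apply: xy; apply: Sinj; rewrite !SE cxy.
  have := hv x; have := hv y; move: rxy.
  by case: (h x) (v x) (h y) (v y) => [] [] [] [].
apply: (@pattern_free_of_flags R _ _ _ c h v) => // x y xy.
have Dxy : x <> y by move=> E; rewrite E lt_irr in xy.
have meetE : S x `&` S y !=set0 <-> [&& h x, v y & c y <= c x + 1].
  rewrite !SE; have := lt_le _ _ xy.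
  rewrite le_eqVlt => /predU1P[cxy|cxy]; last first.
    exact: shapes_meet.
  split=> _.
    by have /andP[-> ->] := lt_tie _ _ cxy xy; rewrite cxy lerDl ler01.
  exists (c x, - c x); split; first exact: shape_corner.
  by rewrite cxy; apply: shape_corner.
apply/idP/idP => [Nxy|/meetE M].
  apply/meetE; apply: contrapT => N; move/negP: Nxy; apply; apply/eE.
  by split=> // -[].
by apply/negP => /eE[_]; apply.
Qed.

Lemma pattern_free_co_unit_hook_stick (f : 'I_#|V| -> V) : bijective f ->
  pattern_free (relpre f e) (@ordinal_lt #|V|) -> co_unit_hook_stick R e.
Proof.
case=> g fK gK free; set e' := relpre f e in free.
have [p pP] := exists_unit_placement R #|V|
  (fun x => reaches_ge e' (leqnn x)) (@reaches_mono _ e').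
have hv i : starts e' i || ends e' i by rewrite /ends orbA orbN.
pose S x := shape (p (g x)) (starts e' (g x)) (ends e' (g x)).
have p_lt (i j : 'I_#|V|) : (i < j)%N -> p i < p j.
  by move=> ij; have [] := pP i j ij (ltn_ord j).
have S_lt x y : (g x < g y)%N -> e x y <-> ~ (S x `&` S y !=set0).
  move=> xy; rewrite (shapes_meet _ _ _ _ (p_lt _ _ xy)).
  suff -> : e x y =
      ~~ [&& starts e' (g x), ends e' (g y) & p (g y) <= p (g x) + 1].
    by split=> /negP.
  rewrite -[e x y]negbK; congr (~~ _).
  have -> : e x y = e' (g x) (g y) by rewrite /e' /= !gK.
  rewrite (nonedgeE free xy); congr [&& _, _ & _].
  have [_] := pP _ _ xy (ltn_ord _).
  by case: ifP => _ pxy; rewrite ?(ltW pxy) ?leNgt ?pxy.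
have g_neq x y : x <> y -> (g x < g y)%N \/ (g y < g x)%N.
  move=> xy; apply/orP; rewrite -neq_ltn; apply/negP => /eqP/ord_inj.
  by move/(can_inj gK).
exists S; split=> [x y /shape_corner_inj pxy|x|x y].
- apply: contrapT => /g_neq[] /p_lt; rewrite pxy ?ltxx //; exact: hv.
- apply/unit_shapeP; exists (p (g x)), (starts e' (g x)), (ends e' (g x)).
  by split.
split=> [exy|[xy Nadj]].
  have xy : x <> y by move=> E; rewrite E e_irr in exy.
  split=> // -[_]; have [gxy|gyx] := g_neq x y xy; first by apply/S_lt.
  by rewrite setIC; apply/S_lt; rewrite // e_sym.
have [gxy|gyx] := g_neq x y xy; first by apply/(S_lt _ _ gxy) => M; apply: Nadj.
rewrite e_sym; apply/(S_lt _ _ gyx) => M; apply: Nadj; split=> //.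
by rewrite setIC.
Qed.

End HookStick.

Theorem theorem30 (R : realType) (V : finType) (e : rel V)
    (e_sym : symmetric e) (e_irr : irreflexive e) :
  (representable12_avoiding [:: 1; 2; 3] e <->
   exists lt : rel V,
     strict_linear_order lt /\
     [/\ ~ pattern_a e lt, ~ pattern_b e lt, ~ pattern_c e lt
       & ~ pattern_d e lt]) /\
  ((exists lt : rel V,
     strict_linear_order lt /\
     [/\ ~ pattern_a e lt, ~ pattern_b e lt, ~ pattern_c e lt
       & ~ pattern_d e lt]) <->
   co_unit_hook_stick R e).
Proof.
split; split.
- case=> f [fbij [w [wrep wav]]]; apply/pattern_free_enumeration.
  by exists f => //; apply/pattern_free_wordP; exists w.
- case/pattern_free_enumeration=> f fbij /pattern_free_wordP[w [wrep wav]].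
  by exists f; split=> //; exists w.
- case/pattern_free_enumeration=> f; exact: pattern_free_co_unit_hook_stick.
- exact: co_unit_hook_stick_ordering.
Qed.
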